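(* Assume the Continuum Hypothesis. Then there is a game $G=(\pi_1,\pi_2)$ with Polish strategy spaces $X_1,X_2$ and bounded payoffs, whose best response relations $E_i^G\subseteq X_i\times\Delta(X_j)$ are universally measurable, and there is a rationalizable strategy of $G$ that is not consistent with Rationality and Common Belief in Rationality; i.e. $\mathrm{RAT}_i(G)\not\subseteq\mathrm{RCBR}_i(G)$ for some $i\in\{1,2\}$.
   Context: Conventions (in $\mathsf{ZFC}$). For a Polish space $X$, $\Delta(X)$ is the Polish space of Borel probability measures on $X$ (weak topology). A measure is identified with its completion; for arbitrary $S\subseteq X$, ''$\mu(S)=1$'' means $S$ is measurable for the completion of $\mu$ and has measure one. A set is universally measurable if it is measurable for the completion of every Borel probability measure. Always $\{i,j\}=\{1,2\}$. Games. A (two-person strategic form) game $G=(\pi_1,\pi_2)$ is a pair of bounded (universally measurable) functions $\pi_i:X_1\times X_2\to\mathbb{R}$, with $X_1,X_2$ Polish (strategy spaces). For $s\in X_i$ and $\mu\in\Delta(X_j)$, $\pi_i(s,\mu)$ is the integral over $y\in X_j$ with respect to $\mu$ of player $i$'s payoff when $i$ plays $s$ and $j$ plays $y$. $s$ is a best response to $\mu$ if $\pi_i(s,\mu)\ge\pi_i(\bar s,\mu)$ for all $\bar s\in X_i$. Let $E_i^G=\{(s,\mu)\in X_i\times\Delta(X_j) : s\text{ is a best response to }\mu\}$. Rationalizability. Put $X_i^0=X_i$; $X_i^{\alpha+1}=\{s\in X_i^\alpha : \exists\mu\in\Delta(X_j)\ (\mu(X_j^\alpha)=1 \text{ and } (s,\mu)\in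 E_i^G)\}$; and $X_i^\alpha=\bigcap_{\beta<\alpha}X_i^\beta$ for limit $\alpha$. With $\alpha$ least such that $X_i^{\alpha+1}=X_i^\alpha$ for both $i$, $\mathrm{RAT}_i(G)=X_i^\alpha$ is the set of rationalizable strategies of player $i$. Type spaces. Put $X_i^{(0)}=X_j$ and $X_i^{(n)}=X_i^{(n-1)}\times\Delta(X_j^{(n-1)})$ for $n>0$. Let $T_i^0=\prod_{n>0}\Delta(X_i^{(n-1)})$, and let $T_i^1\subseteq T_i^0$ be the set of sequences $\delta_i=(\delta_i^1,\delta_i^2,\dots)$ with $\mathrm{marg}_{X_i^{(n-2)}}(\delta_i^n)=\delta_i^{n-1}$ for all $n>1$. By Kolmogorov extension each $\delta_i\in T_i^1$ determines a unique $\delta_i^*\in\Delta(X_j\times T_j^0)$ with $\mathrm{marg}_{X_i^{(n)}}\delta_i^*=\delta_i^{n+1}$ for all $n\ge 0$. For $k>1$ let $T_i^k=\{\delta_i\in T_i^1:\delta_i^*(X_j\times T_j^{k-1})=1\}$ and $T_i=\bigcap_{k\geq 1}T_i^k$. Then $T_i$ is Polish and $\lambda_i(\delta_i)=\delta_i^*$ defines a homeomorphism $\lambda_i:T_i\to\Delta(X_j\times T_j)$. RCBR. Let $R_i^1=\{(s,t)\in X_i\times T_i : (s,\mathrm{marg}_{X_j}\lambda_i(t))\in E_i^G\}$ and $R_i^{n+1}=\{(s,t)\in R_i^n : \lambda_i(t)(R_j^n)=1\}$ for $n\ge1$. $\mathrm{RCBR}_i(G)=\{s\in X_i:\exists t\in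 T_i\ \forall n\ge 1\ (s,t)\in R_i^n\}$ is the set of strategies of player $i$ consistent with Rationality and Common Belief in Rationality. *)

(* Defs.v *)
From HB Require Import structures.
From mathcomp Require Import all_boot all_order all_algebra.
From mathcomp Require Import all_classical all_reals all_analysis.
From mathcomp Require Import wochoice measurable_realfun.

Set Implicit Arguments.
Unset Strict Implicit.
Unset Printing Implicit Defensive.

Import Order.TTheory GRing.Theory Num.Theory.
Import numFieldNormedType.Exports.

Local Open Scope classical_set_scope.
Local Open Scope ring_scope.

Definition continuum_hypothesis (R : realType) : Prop :=
  forall A : set R, countable A \/ (A #= [set: R])%card.

Definition is_metric (R : realType) (T : Type) (d : T -> T -> R) : Prop :=
  [/\ forall x y, 0 <= d x y,
      forall x y, d x y = 0 <-> x = y,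
      forall x y, d x y = d y x
    & forall x y z, d x z <= d x y + d y z].

Definition metrizes (R : realType) (T : topologicalType) (d : T -> T -> R) :
    Prop :=
  forall (x : T) (A : set T),
    nbhs x A <-> exists2 e : R, 0 < e & [set y | d x y < e] `<=` A.

Definition metric_complete (R : realType) (T : topologicalType)
    (d : T -> T -> R) : Prop :=
  forall u : nat -> T,
    (forall e : R, 0 < e -> exists N : nat, forall m n : nat,
      (N <= m)%N -> (N <= n)%N -> d (u m) (u n) < e) ->
    exists l : T, u @ \oo --> l.

Definition polish (R : realType) (T : topologicalType) : Prop :=
  (exists2 D : set T, countable D & dense D) /\
  (exists d : T -> T -> R, [/\ is_metric d, metrizes d & metric_complete d]).

(* The completion of a measure: the sigma-algebra consists of the sets A `|` N
   with A measurable and N negligible, on which the completed measure is the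
   restriction of the outer measure mu^*, i.e. A `|` N has measure mu A. *)
Definition completion_type d (T : measurableType d) (R : realType)
  (mu : {measure set T -> \bar R}) : Type := T.

Section completion.
Context d (T : measurableType d) (R : realType)
  (mu : {measure set T -> \bar R}).
Local Open Scope ereal_scope.
Local Notation cT := (completion_type mu).

HB.instance Definition _ := Pointed.on cT.

Let calg0 : completed_algebra_gen mu set0.
Proof. by exists set0 => //; exists set0; [exact: negligible_set0|rewrite setU0]. Qed.

Let calgC (G : set T) :
  completed_algebra_gen mu G -> completed_algebra_gen mu (~` G).
Proof.
move=> [A mA [N [F [mF F0 NF]] ANG]].
exists (~` A `\` F); first by apply: measurableD => //; exact: measurableC.
exists ((~` A `&` F) `\` N); first by exists F; split => // x [[]].
rewrite -ANG; apply/seteqP; split=> x /=.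
  move=> [[nA nF]|[[nA Fx] nN]]; first by move=> [//|/NF].
  by move=> [].
move=> /not_orP[nA nN]; have [Fx|nF] := pselect (F x); first by right.
by left.
Qed.

Let calgU (G : (set T)^nat) :
  (forall i, completed_algebra_gen mu (G i)) ->
  completed_algebra_gen mu (\bigcup_i G i).
Proof.
move=> mG.
pose A n := projT1 (cid2 (mG n)).
pose N n := projT1 (cid2 (projT2 (cid2 (mG n))).2).
exists (\bigcup_k A k).
  by apply: bigcupT_measurable => i; rewrite /A; case: cid2.
exists (\bigcup_k N k).
  apply: negligible_bigcup => /= k.
  by rewrite /N; case: (cid2 (mG k)) => //= *; case: cid2.
rewrite -bigcupU; apply: eq_bigcup => // i _.
by rewrite /A /N; case: (cid2 (mG i)) => //= *; case: cid2.
Qed.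

Definition completion_display : measure_display. Proof. by constructor. Qed.

HB.instance Definition _ := @isMeasurable.Build completion_display cT
  (completed_algebra_gen mu) calg0 calgC calgU.

Definition completed (A : set cT) : \bar R := (mu^*)%mu A.

Let calg_sub_cara (A : set cT) : measurable A -> (mu^*)%mu.-cara.-measurable A.
Proof.
move=> [B mB [N [F [mF F0 NF]] <-]]; apply: measurableU.
  exact: caratheodory_measurable_mu_ext.
apply: measure_is_complete_caratheodory; exists F; split => //.
  exact: caratheodory_measurable_mu_ext.
by rewrite /= measurable_mu_extE.
Qed.

Let completed0 : completed set0 = 0.
Proof. exact: mu_ext0. Qed.

Let completed_ge0 A : 0 <= completed A.
Proof. exact: mu_ext_ge0. Qed.

Let completed_sigma_additive : semi_sigma_additive completed.
Proof.
move=> F mF tF mUF; apply: caratheodory_measure_sigma_additive => //.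
- by move=> i; exact: calg_sub_cara.
- exact: calg_sub_cara.
Qed.

HB.instance Definition _ := isMeasure.Build _ _ _ completed
  completed0 completed_ge0 completed_sigma_additive.

Definition completion : {measure set cT -> \bar R} := completed.

End completion.

HB.instance Definition _ (X Y : ptopologicalType) := Pointed.on (X * Y)%type.

HB.instance Definition _ (I : Type) (T : I -> ptopologicalType) :=
  isPointed.Build (prod_topology T) (fun i => point).

Notation borel T := (g_sigma_algebraType (@open T)).

(* A library measure is a function on all subsets whose values off the
   sigma-algebra are unconstrained; they are set to 0 here, so that elements of
   Delta R T are in bijection with the Borel probability measures on T. *)
Definition Delta (R : realType) (T : ptopologicalType) : Type :=
  {P : probability (borel T) R | forall A, ~ measurable A -> P A = 0%E}.

Section normalization.
Context (R : realType) (T : ptopologicalType) (P : probability (borel T) R).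
Local Open Scope ereal_scope.

Definition zero_off (A : set (borel T)) : \bar R :=
  if pselect (measurable A) then P A else 0.

Let zero_offE A : measurable A -> zero_off A = P A.
Proof. by rewrite /zero_off; case: pselect. Qed.

Let zero_off0 : zero_off set0 = 0.
Proof. by rewrite zero_offE. Qed.

Let zero_off_ge0 A : 0 <= zero_off A.
Proof. by rewrite /zero_off; case: pselect => ?; [exact: measure_ge0|exact: lexx]. Qed.

Let zero_off_sigma_additive : semi_sigma_additive zero_off.
Proof.
move=> F mF tF mUF; rewrite zero_offE//.
rewrite (_ : (fun n => _) = (fun n => \sum_(0 <= i < n) P (F i))).
  exact: measure_semi_sigma_additive.
by apply/funext => n; apply: eq_bigr => i _; rewrite zero_offE.
Qed.

HB.instance Definition _ := isMeasure.Build _ _ _ zero_off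
  zero_off0 zero_off_ge0 zero_off_sigma_additive.

Let zero_offT : zero_off setT = 1.
Proof. by rewrite zero_offE// probability_setT. Qed.

HB.instance Definition _ := Measure_isProbability.Build _ _ _ zero_off zero_offT.

Lemma zero_off_nmeas A : ~ measurable A -> zero_off A = 0.
Proof. by rewrite /zero_off; case: pselect. Qed.

Definition mkDelta : Delta R T := exist _ (zero_off : probability _ _) zero_off_nmeas.

End normalization.

Section weak_topology_on_Delta.
Context (R : realType) (T : ptopologicalType).

Definition bounded_continuous : Type :=
  {f : T -> R | continuous f /\ exists M : R, forall x, `|f x| <= M}.

HB.instance Definition _ := gen_eqMixin bounded_continuous.
HB.instance Definition _ := gen_choiceMixin bounded_continuous.

Definition expectations (mu : Delta R T) :
    prod_topology (fun _ : bounded_continuous => (R : topologicalType)) :=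
  fun f => \int[sval mu]_(x in [set: borel T]) (sval f x).

HB.instance Definition _ := gen_eqMixin (Delta R T).
HB.instance Definition _ := gen_choiceMixin (Delta R T).
HB.instance Definition _ :=
  isPointed.Build (Delta R T) (mkDelta (dirac (point : borel T))).
HB.instance Definition _ :=
  Topological.copy (Delta R T) (initial_topology expectations).

End weak_topology_on_Delta.

Section measure_notions.
Context (R : realType).
Implicit Types T U : ptopologicalType.

Definition completion_measurable T (mu : Delta R T) (S : set T) : Prop :=
  measurable (S : set (completion_type (sval mu))).

Definition full T (mu : Delta R T) (S : set T) : Prop :=
  completion_measurable mu S /\ completion (sval mu) S = 1%E.

Definition universally_measurable T (S : set T) : Prop :=
  forall mu : Delta R T, completion_measurable mu S.

Definition universally_measurable_fun T (f : T -> R) : Prop :=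
  forall B : set R, measurable B -> universally_measurable (f @^-1` B).

(* nu is the image of mu under f, hence a marginal of mu if f is a projection. *)
Definition image_measure T U (f : T -> U) (mu : Delta R T) (nu : Delta R U) :
    Prop :=
  forall A : set (borel U), measurable A -> sval nu A = sval mu (f @^-1` A).

End measure_notions.

Record game (R : realType) := Game {
  X1 : ptopologicalType;
  X2 : ptopologicalType;
  payoff1 : X1 * X2 -> R;
  payoff2 : X1 * X2 -> R;
  polish1 : polish R X1;
  polish2 : polish R X2;
  bounded1 : exists M : R, forall p, `|payoff1 p| <= M;
  bounded2 : exists M : R, forall p, `|payoff2 p| <= M;
  umeas1 : @universally_measurable_fun R (X1 * X2)%type payoff1;
  umeas2 : @universally_measurable_fun R (X1 * X2)%type payoff2
}.

Variant player := P1 | P2.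

Definition other (i : player) : player := if i is P1 then P2 else P1.

Unset Implicit Arguments.

Section game_notions.
Context {R : realType} (G : game R).

Definition strat (i : player) : ptopologicalType :=
  match i with P1 => X1 G | P2 => X2 G end.

Definition own_payoff {i : player} : strat i -> strat (other i) -> R :=
  match i with
  | P1 => fun s y => payoff1 (g := G) (s, y)
  | P2 => fun s y => payoff2 (g := G) (y, s)
  end.

Definition expected_payoff {i : player} (s : strat i)
    (mu : Delta R (strat (other i))) : R :=
  \int[completion (sval mu)]_y own_payoff s y.

Definition best_response {i : player} (s : strat i)
    (mu : Delta R (strat (other i))) : Prop :=
  forall s' : strat i, expected_payoff s' mu <= expected_payoff s mu.

Definition BR (i : player) : set (strat i * Delta R (strat (other i))) :=
  [set p | best_response p.1 p.2].

Definition eliminate (A : forall i, set (strat i)) : forall i, set (strat i) :=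
  fun i => A i `&`
    [set s | exists mu, full mu (A (other i)) /\ BR i (s, mu)].

Section transfinite_elimination.
Context {W : eqType} (r : rel W).

Definition prec (b a : W) : Prop := r b a /\ b <> a.

Definition is_zero (a : W) : Prop := forall b, ~ prec b a.

Definition is_succ (b a : W) : Prop :=
  prec b a /\ forall c, ~ (prec b c /\ prec c a).

Definition is_limit (a : W) : Prop :=
  ~ is_zero a /\ forall b, ~ is_succ b a.

(* The elements of a well-order stand for the ordinals below its order type. *)
Definition elimination_sequence (A : W -> forall i, set (strat i)) : Prop :=
  forall a,
  [/\ is_zero a -> forall i, A a i = setT,
      forall b, is_succ b a -> forall i, A a i = eliminate (A b) i
    & is_limit a -> forall i, A a i = \bigcap_(b in [set b | prec b a]) A b i].

Definition stationary (A : W -> forall i, set (strat i)) (a : W) : Prop :=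
  forall i, eliminate (A a) i = A a i.

Definition least_stationary (A : W -> forall i, set (strat i)) (a : W) : Prop :=
  stationary A a /\ forall b, prec b a -> ~ stationary A b.

End transfinite_elimination.

Definition RAT (i : player) : set (strat i) :=
  [set s | exists (W : eqType) (r : rel W) (A : W -> forall i, set (strat i))
             (a : W),
    [/\ well_order r, elimination_sequence r A, least_stationary r A a
      & A a i s]].

Fixpoint hier (n : nat) (i : player) : ptopologicalType :=
  match n with
  | 0 => strat (other i)
  | n'.+1 => (hier n' i * Delta R (hier n' (other i)))%type
  end.

(* Coordinates are shifted by one: d n is the belief of order n + 1. *)
Definition beliefs (i : player) : ptopologicalType :=
  prod_topology ((fun n => Delta R (hier n i)) : nat -> ptopologicalType).

Definition coherent (i : player) : set (beliefs i) :=
  [set d | forall n : nat,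
    @image_measure R (hier n.+1 i) (hier n i) fst (d n.+1) (d n)].

Fixpoint truncate (n : nat) (i : player) :
    strat (other i) * beliefs (other i) -> hier n i :=
  match n with
  | 0 => fun p => p.1
  | n'.+1 => fun p => (truncate n' i p, p.2 n')
  end.

(* nu is the Kolmogorov extension of d: on Polish spaces, a coherent d has
   exactly one. *)
Definition star {i : player} (d : beliefs i)
    (nu : Delta R (strat (other i) * beliefs (other i))%type) : Prop :=
  forall n : nat, image_measure (truncate n i) nu (d n).

(* Stages are numbered from 0: type_stage k and rationality k are the stages
   usually indexed by k + 1. *)
Fixpoint type_stage (k : nat) (i : player) : set (beliefs i) :=
  match k with
  | 0 => coherent i
  | k'.+1 => coherent i `&`
      [set d | exists nu, star d nu /\ full nu (setT `*` type_stage k' (other i))]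
  end.

Definition types (i : player) : set (beliefs i) := \bigcap_k type_stage k i.

(* The belief of a type d over strat (other i) * types (other i) is the measure
   nu with star d nu, kept as a measure on strat (other i) * beliefs (other i):
   it is concentrated on the Borel set strat (other i) * types (other i), and the
   sets measured below are subsets of it. *)
Fixpoint rationality (n : nat) (i : player) : set (strat i * beliefs i) :=
  match n with
  | 0 => [set p | types i p.2 /\ exists nu mu,
            [/\ star p.2 nu, image_measure fst nu mu & BR i (p.1, mu)]]
  | n'.+1 => rationality n' i `&`
      [set p | exists nu, star p.2 nu /\ full nu (rationality n' (other i))]
  end.

Definition RCBR (i : player) : set (strat i) :=
  [set s | exists2 t, types i t & forall n : nat, rationality n i (s, t)].

End game_notions.

(* Main.v *)
Require Import Defs.
From mathcomp Require Import all_boot all_order all_algebra.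
From mathcomp Require Import all_classical all_reals all_analysis.
From HB Require Import structures.
From mathcomp Require Import wochoice measurable_realfun ring lra.

(* Under CH there is a family x s (s real) of sequences of naturals such that
   every g : nat -> nat eventually dominates only countably many of them.  For
   a Borel probability P on nat^nat some g eventually dominates P-almost every
   sequence, so a measure carried by the pairs (x s, s) is carried by countably
   many of them; in particular the graph of x is universally measurable.
     Player 1 chooses y : nat^nat and player 2 a real s.  Player 2 gets 1 if
   s = 0 or y = x s, and 0 otherwise, so that s != 0 is a best response only to
   the point mass at x s.  The payoff of player 1 depends on (y 0, s) only: one
   value of y 0 always earns 0, the others code test functions of s whose means
   are all nonpositive under the uniform distribution, and which can only have
   nonpositive means under a nonatomic distribution.  Every strategy is a best
   response to some measure, so all are rationalizable.  A type justifying the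
   constant payoff 0 would be a measure on pairs (strategy, type) of player 2
   with nonatomic first marginal for which almost every s <> 0 comes with the
   belief x s, which is impossible. *)

Set Implicit Arguments.
Unset Strict Implicit.
Unset Printing Implicit Defensive.

Import Order.TTheory GRing.Theory Num.Theory.
Import numFieldNormedType.Exports.

Local Open Scope classical_set_scope.
Local Open Scope ring_scope.

(** * Coding sequences by reals, and the scale obtained from CH *)

Lemma countable_setU T (A B : set T) :
  countable A -> countable B -> countable (A `|` B).
Proof.
by move=> cA cB; rewrite -bigcup2E; apply: bigcup_countable => // -[|[|?]].
Qed.

Section base4.
Context {R : realType}.
Implicit Types b : nat -> bool.

(* With digits 0 and 1 only, base 4 expansions are unique. *)
Definition base4_sum b (n : nat) : R := \sum_(k < n) (b k)%:R * 4^-1 ^+ k.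

(** The subtracted term makes the upper bound inductive: passing from [n] to [n.+1] raises it by
    (3/2) 4^-n, while a digit adds at most 4^-n. *)
Lemma base4_sum_tail b m n : (m <= n)%N ->
  base4_sum b m <= base4_sum b n <= base4_sum b m + 2 * 4^-1 ^+ m - 2 * 4^-1 ^+ n.
Proof.
move=> /subnK <-; elim: (n - m)%N => [|d /andP[h1 h2]].
  by rewrite add0n lexx /= addrK.
have p : 0 < 4^-1 ^+ (d + m) :> R by rewrite exprn_gt0.
rewrite addSn [base4_sum b (d + m).+1]big_ord_recr /= -/(base4_sum b (d + m)) exprS.
move: h1 h2 p; case: (b _); rewrite ?mul0r ?mul1r.
  by move: (4^-1 ^+ (d + m)) (4^-1 ^+ m) => x y *; apply/andP; split; lra.
by move: (4^-1 ^+ (d + m)) (4^-1 ^+ m) => x y *; apply/andP; split; lra.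
Qed.

Definition base4 b : R := sup (range (base4_sum b)).

Lemma base4_bounds b m : base4_sum b m <= base4 b <= base4_sum b m + 2 * 4^-1 ^+ m.
Proof.
have ub : ubound (range (base4_sum b)) (base4_sum b m + 2 * 4^-1 ^+ m).
  move=> _ [n _ <-]; have [mn|/ltnW nm] := leqP m n.
    have /andP[_] := base4_sum_tail b mn.
    by have : 0 < 4^-1 ^+ n :> R; [rewrite exprn_gt0|lra].
  have /andP[+ _] := base4_sum_tail b nm.
  by have : 0 < 4^-1 ^+ m :> R; [rewrite exprn_gt0|lra].
apply/andP; split.
  by apply: ub_le_sup; [exists (base4_sum b m + 2 * 4^-1 ^+ m)|exists m].
by apply: ge_sup => //; exists (base4_sum b m); exists m.
Qed.

(** At the first difference n, the digit 1 contributes 4^-n, while all later digits of the other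
    sequence contribute at most 2 * 4^-(n+1), half of that. *)
Lemma base4_inj : injective base4.
Proof.
have key b c n : (forall k, (k < n)%N -> b k = c k) -> b n -> ~~ c n ->
    base4 c < base4 b.
  move=> bc bn cn; have /andP[h _] := base4_bounds b n.+1.
  have /andP[_ h'] := base4_bounds c n.+1.
  have e : base4_sum b n = base4_sum c n.
    by apply: eq_bigr => i _; rewrite bc.
  have p : 0 < 4^-1 ^+ n :> R by rewrite exprn_gt0.
  move: h h'; rewrite [base4_sum b _]big_ord_recr [base4_sum c _]big_ord_recr /=.
  rewrite bn (negbTE cn).
  by rewrite -/(base4_sum b n) -/(base4_sum c n) e exprS mul1r mul0r;
    move: (4^-1 ^+ n) p => x; lra.
move=> b c e; apply/funext => n; elim/ltn_ind: n => n IH.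
case bn: (b n); case cn: (c n) => //.
  by have := key b c n IH bn (negbT cn); rewrite e ltxx.
by have := key c b n (fun k kn => esym (IH k kn)) cn (negbT bn); rewrite e ltxx.
Qed.

End base4.

(** A sequence is coded by the characteristic function of its graph, read as a base 4 expansion; [e]
    decodes, with the zero sequence as default. *)
Lemma sequences_enumerated_by_reals (R : realType) :
  exists e : R -> nat -> nat, forall g, exists t, e t = g.
Proof.
pose b (g : nat -> nat) k :=
  if unpickle k is Some (i, j) then g i == j else false.
have binj : injective b.
  move=> g h gh; apply/funext => i.
  have := congr1 (fun b => b (pickle (i, g i))) gh.
  by rewrite /b pickleK eqxx => /esym/eqP.
exists (fun t => if pselect (exists g, base4 (b g) = t) is left p then projT1 (cid p)
                 else fun=> 0%N) => g.
exists (base4 (b g)); case: pselect => [p|[]]; last by exists g.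
by case: cid => h /= /base4_inj /binj.
Qed.

(** CH provides a well-order of the reals whose initial segments are all countable; [L] is that
    order, and by totality the reals not above a given one lie in its initial segment. *)
Lemma CH_sierpinski_relation (R : realType) : continuum_hypothesis R ->
  exists L : R -> R -> Prop, forall s : R,
    countable [set t | L t s] /\ countable [set t | ~ L s t].
Proof.
move=> CH; have [r wor] := well_ordering_principle R.
have tot x y : r x y \/ r y x.
  have [|z [[zxy zm] _]] := wor (pred2 x y); first by exists x; rewrite !inE eqxx.
  by move: zxy; rewrite !inE => /orP[]/eqP zE; [left|right];
    rewrite -zE; apply: zm; rewrite !inE eqxx ?orbT.
have refl x : r x x by have [] := tot x x.
have anti x y : r x y -> r y x -> x = y.
  move=> rxy ryx; have [|z [_ zu]] := wor (pred2 x y).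
    by exists x; rewrite !inE eqxx.
  transitivity z; [apply/esym/zu|apply/zu]; split; rewrite ?inE ?eqxx ?orbT //;
    by move=> t; rewrite !inE => /orP[]/eqP->.
have [I [II H]] : exists I : set R, (I #= [set: R])%card /\
    forall s, I s -> countable [set t | I t /\ r t s].
  (* If some initial segment is uncountable, [I] is the set of strict predecessors of the least such
     point: it is uncountable, hence as large as the reals by CH, and by minimality its own segments
     are countable. Otherwise [I] is everything. *)
  pose P := [pred a : R | `[< ~ countable [set t | r t a] >]].
  have inP a : (a \in P) <-> ~ countable [set t | r t a] by split => /asboolP.
  have [/wor [a [[aP am] _]]|noP] := pselect (nonempty P); last first.
    exists setT; split => // s _.
    apply: contrapT => H; apply: noP; exists s; apply/inP => H'; apply: H.
    by apply: sub_countable H'; apply: subset_card_le => x [].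
  exists [set t | r t a /\ t <> a]; split.
    have [cI|//] := CH [set t | r t a /\ t <> a].
    move/inP: aP; case.
    have : countable ([set t | r t a /\ t <> a] `|` [set a]).
      by apply: countable_setU; [exact: cI|exact: countable1].
    move=> h; apply: sub_countable h; apply: subset_card_le => t rta.
    by have [->|ta] := pselect (t = a); [right|left].
  move=> s [rsa sa]; apply: contrapT => H; apply: sa.
  apply: anti => //; apply: am; apply/inP => H'.
  by apply: H; apply: sub_countable H'; apply: subset_card_le => x [].
have /pcard_leP[b] : ([set: R] #<= I)%card by have /card_eqPle[] := II.
have cpre s : countable [set t | r (b t) (b s)].
  have h : countable (b @` [set t | r (b t) (b s)]).
    apply: sub_countable (H (b s) _); last exact: funS.
    by apply: subset_card_le => _ [t rts <-]; split => //; exact: funS.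
  apply: sub_countable h.
  suff /card_eqPle[] :
    (b @` [set t | r (b t) (b s)] #= [set t | r (b t) (b s)])%card by [].
  by apply: inj_card_eq => x y _ _; apply: inj; rewrite in_setT.
exists (fun t s => r (b t) (b s)) => s; split; first exact: cpre.
apply: sub_countable (cpre s); apply: subset_card_le => t /= /negP nst.
by have [/(negP nst)|] := tot (b s) (b t).
Qed.

(* x s dominates the sequences e t with L t s, which are countably many. *)
Lemma CH_scale (R : realType) : continuum_hypothesis R ->
  exists x : R -> nat -> nat, forall g : nat -> nat,
    countable [set s | exists n, forall k, (n <= k)%N -> (x s k <= g k)%N].
Proof.
move=> /CH_sierpinski_relation[L HL]; have [e esurj] := sequences_enumerated_by_reals R.
have /choice[x Hx] : forall s, exists f : nat -> nat,
    forall t, L t s -> exists n, forall k, (n <= k)%N -> (e t k < f k)%N.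
  move=> s; have [/countable_injP[i iinj] _] := HL s.
  have /choice[c Hc] : forall n : nat, exists t,
      forall t', L t' s -> i t' = n -> t' = t.
    move=> n; have [[t [Lts itn]]|H] := pselect (exists t, L t s /\ i t = n).
      by exists t => t' Lt' it'; apply: iinj; rewrite ?inE //= it'.
    by exists 0 => t' Lt' it'; case: H; exists t'.
  (* Diagonal bound: [c] inverts the enumeration [i], so from k = i t on the maximum includes the
     value of [e t], and the successor makes the inequality strict. *)
  exists (fun k => (\max_(j < k.+1) e (c j) k).+1) => t Lts; exists (i t) => k itk.
  by rewrite (Hc (i t) t) // ltnS (leq_bigmax (Ordinal (_ : (i t < k.+1)%N))).
(* If [L t s] holds, [x s] eventually exceeds [e t]; so the dominated [x s] have s in the countable
   set where [L t s] fails. *)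
exists x => g; have [t <-] := esurj g; apply: sub_countable (HL t).2.
apply: subset_card_le => s [n Hn] /Hx[m Hm].
have := Hm _ (leq_maxr n m); by rewrite ltnNge Hn // leq_maxl.
Qed.

(** * Borel-Cantelli and countable unions *)

Lemma null_limsup_exists d (Z : measurableType d) (R : realType)
    (P : probability Z R) (U : nat -> nat -> set Z) :
  (forall k m, measurable (U k m)) -> (forall k m, U k m.+1 `<=` U k m) ->
  (forall k, \bigcap_m U k m = set0) ->
  exists g, P (lim_sup_set (fun k => U k (g k))) = 0%E.
Proof.
move=> mU Ud U0.
(* Continuity from above yields summable bounds, and Borel-Cantelli concludes. The summand 0 gives
   the bounds the shape of [epsilon_trick]. *)
have /choice[g Hg] : forall k, exists m, (P (U k m) <= 0 + (1 / (2 ^ k.+1)%:R)%:E)%E.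
  move=> k; have : (P \o U k) @ \oo --> P (\bigcap_m U k m).
    apply: nonincreasing_cvg_mu => //.
    - by rewrite (le_lt_trans (probability_le1 _ _)) // ltry.
    - exact: bigcapT_measurable.
    - by apply/nonincreasing_seqP => m; apply/subsetPset.
  rewrite U0 measure0 => /fine_cvgP[fU /cvgrPdist_lt] /(_ (1 / (2 ^ k.+1)%:R)).
  have p : 0 < 1 / (2 ^ k.+1)%:R :> R by rewrite divr_gt0 // ltr0n expn_gt0.
  move=> /(_ p) [m _ Hm]; exists m; move: (Hm m (leqnn m)) => /=.
  rewrite sub0r normrN add0e => /ltW h.
  rewrite -[P (U k m)]fineK ?fin_num_measure // lee_fin.
  exact: le_trans (ler_norm _) h.
exists g; apply: lim_sup_set_cvg0 => //.
apply: (@le_lt_trans _ _ (\sum_(i <oo) (0 + (1 / (2 ^ i.+1)%:R)%:E))%E).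
  by apply: lee_nneseries => [i _ _|n _]; [exact: measure_ge0|exact: Hg].
apply: le_lt_trans (epsilon_trick xpredT _ _) _ => //.
by rewrite eseries0 // add0e ltry.
Qed.

Lemma countable_bigcup_measurable d (Z : measurableType d) I (A : set I)
    (F : I -> set Z) :
  countable A -> (forall i, A i -> measurable (F i)) ->
  measurable (\bigcup_(i in A) F i).
Proof.
move=> /pfcard_geP[->|[f]] mF; first by rewrite bigcup_set0.
rewrite (_ : \bigcup_(i in A) F i = \bigcup_n F (f n)).
  by apply: bigcupT_measurable => n; apply: mF; exact: funS.
apply/seteqP; split => z [i Ai Fz].
  by have [n _ fn] := 'surj_f Ai; exists n => //; rewrite fn.
by exists (f i) => //; exact: funS.
Qed.

Lemma countable_bigcup_negligible d (Z : measurableType d) (R : realType)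
    (mu : {measure set Z -> \bar R}) I (A : set I) (F : I -> set Z) :
  countable A -> (forall i, A i -> mu.-negligible (F i)) ->
  mu.-negligible (\bigcup_(i in A) F i).
Proof.
move=> /pfcard_geP[->|[f]] nF; first by rewrite bigcup_set0; exact: negligible_set0.
apply: (@negligibleS _ _ _ _ (\bigcup_n F (f n))).
  by move=> z [i Ai Fz]; have [n _ fn] := 'surj_f Ai; exists n => //; rewrite fn.
by apply: negligible_bigcup => n; apply: nF; exact: funS.
Qed.

(** * Borel sets, completions and integrals *)

Section borel.
Context (R : realType).
Implicit Types T U : ptopologicalType.

Lemma borel_open T (A : set T) : open A -> measurable (A : set (borel T)).
Proof. by move=> oA; apply: sub_sigma_algebra. Qed.

Lemma borel_closed T (A : set T) : closed A -> measurable (A : set (borel T)).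
Proof.
move=> cA; rewrite -[A]setCK; apply: measurableC; apply: borel_open.
exact: closed_openC.
Qed.

Lemma continuous_borel T U (f : T -> U) (B : set U) : continuous f ->
  measurable (B : set (borel U)) -> measurable (f @^-1` B : set (borel T)).
Proof.
move=> /continuousP cf.
apply: (@smallest_sub _ _ _ [set B | measurable (f @^-1` B : set (borel T))]).
  split => /=; first by rewrite preimage_set0; exact: measurable0.
    by move=> A mA; rewrite setTD preimage_setC; exact: measurableC.
  by move=> F mF; rewrite preimage_bigcup; exact: bigcupT_measurable.
by move=> A oA; apply: borel_open; exact: cf.
Qed.

Lemma continuous_borel_fun T (f : T -> R) :
  continuous f -> measurable_fun setT (f : borel T -> R).
Proof.
move=> /continuousP cf; apply: (measurability _ (RGenOpens.measurableE R)).
move=> _ [_ [a [b ->] <-]]; rewrite setTI; apply: borel_open.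
exact/cf/interval_open.
Qed.

Lemma measurable_completion_measurable T (mu : Delta R T) (A : set T) :
  measurable (A : set (borel T)) -> completion_measurable mu A.
Proof.
move=> mA; exists A => //; exists set0; last by rewrite setU0.
exact: negligible_set0.
Qed.

Lemma completionE T (mu : Delta R T) (A : set T) :
  measurable (A : set (borel T)) -> completion (sval mu) A = sval mu A.
Proof. by move=> mA; exact: measurable_mu_extE. Qed.

Lemma measurable_universally T (A : set T) :
  measurable (A : set (borel T)) -> universally_measurable R A.
Proof. by move=> mA mu; exact: measurable_completion_measurable. Qed.

Lemma universally_measurableU T (A B : set T) : universally_measurable R A ->
  universally_measurable R B -> universally_measurable R (A `|` B).
Proof. by move=> mA mB mu; apply: measurableU; [exact: mA|exact: mB]. Qed.

Lemma universally_measurableC T (A : set T) : universally_measurable R A ->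
  universally_measurable R (~` A).
Proof. by move=> mA mu; apply: measurableC; exact: mA. Qed.

(** The identity from the completed space to the Borel space is measurable and pushes the completion
    forward to [mu]; the rest is change of variables. *)
Lemma integral_completion T (mu : Delta R T) (f : T -> R) :
  measurable_fun setT (f : borel T -> R) -> (exists M : R, forall x, `|f x| <= M) ->
  \int[completion (sval mu)]_x f x = \int[sval mu]_x f x.
Proof.
move=> mf [M fM]; congr fine.
pose i := (id : completion_type (sval mu) -> borel T).
have mi : measurable_fun setT i.
  by move=> _ A mA; rewrite setTI; exact: measurable_completion_measurable.
have -> : (\int[sval mu]_x (f x)%:E =
    \int[pushforward (completion (sval mu)) i]_x (f x)%:E)%E.
  by apply: eq_measure_integral => A mA _; rewrite /pushforward completionE.
have fc : (completion (sval mu) setT < +oo)%E.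
  by rewrite completionE // (@probability_setT _ _ _ (sval mu)) ltry.
rewrite integral_pushforward //= ?preimage_setT; first exact/measurable_EFinP.
apply: measurable_bounded_integrable => //.
  move=> _ A mA; rewrite setTI; apply: measurable_completion_measurable.
  by rewrite -[X in measurable X]setTI; exact: mf.
exists M; split; first exact: num_real.
by move=> N MN x _ /=; exact: le_trans (fM x) (ltW MN).
Qed.

Lemma bounded_integrable T (P : probability (borel T) R) (f : T -> R) :
  measurable_fun setT (f : borel T -> R) -> (exists M : R, forall x, `|f x| <= M) ->
  P.-integrable setT (EFin \o f).
Proof.
move=> mf [M fM]; apply: measurable_bounded_integrable => //.
  by rewrite ltey_eq fin_num_measure.
exists M; split; first exact: num_real.
by move=> N MN x _ /=; exact: le_trans (fM x) (ltW MN).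
Qed.

Lemma Rintegral_setE T (P : probability (borel T) R) (A : set T) :
  measurable (A : set (borel T)) ->
  \int[P]_x (\1_A x : R) = fine (P A).
Proof. by move=> mA; rewrite /Rintegral integral_indic // setIT. Qed.

End borel.

(** * Null sets and universal measurability from the scale *)

Section scale.
Context (R : realType) (x : R -> nat -> nat).
Hypothesis scale_x : forall g : nat -> nat,
  countable [set s | exists n, forall k, (n <= k)%N -> (x s k <= g k)%N].
Context (T : ptopologicalType) (S : set T) (sigma : T -> R) (U : nat -> nat -> set T).
Hypothesis mU : forall k m, measurable (U k m : set (borel T)).
Hypothesis Ud : forall k m, U k m.+1 `<=` U k m.
Hypothesis U0 : forall k, \bigcap_m U k m = set0.
Hypothesis SU : forall z, S z -> forall k m, (m < x (sigma z) k)%N -> U k m z.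

(** [U k m] is a Borel substitute for the condition that [x (sigma z) k] exceeds m. Choose g with
    the lim sup of the [U k (g k)] null: for z in [S] outside it, g eventually dominates
    [x (sigma z)], which leaves countably many values of [sigma z]. *)
Lemma scale_negligible (P : probability (borel T) R) :
  exists2 A : set R, countable A & P.-negligible (S `\` sigma @^-1` A).
Proof.
have [g Pg] := @null_limsup_exists _ (borel T) R P U mU Ud U0.
exists [set s | exists n, forall k, (n <= k)%N -> (x s k <= g k)%N].
  exact: scale_x.
exists (lim_sup_set (fun k => U k (g k))); split => //.
  by apply: bigcapT_measurable => n; apply: bigcup_measurable => k _; exact: mU.
move=> z [Sz /= H] n _; apply: contrapT => H'; apply: H; exists n => k nk.
rewrite leqNgt; apply/negP => h; apply: H'; exists k => //.
exact: SU.
Qed.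

(** Up to a null set, [S] is the union of countably many fibres of [sigma], each of them Borel. *)
Lemma scale_universally_measurable :
  (forall s, measurable (S `&` sigma @^-1` [set s] : set (borel T))) ->
  universally_measurable R S.
Proof.
move=> mS mu; have [A cA nA] := scale_negligible (sval mu).
exists (\bigcup_(s in A) (S `&` sigma @^-1` [set s])).
  by apply: countable_bigcup_measurable.
exists (S `\` sigma @^-1` A) => //; apply/seteqP; split => z.
  by move=> [[s As [Sz zs]]|[]].
move=> Sz; have [Az|nAz] := pselect (A (sigma z)); [left|by right].
by exists (sigma z).
Qed.

End scale.

(** * The real line and Baire space are Polish *)

Lemma polish_real (R : realType) : polish R R.
Proof.
split.
  exists (range (ratr : rat -> R)); last exact: dense_rat.
  by apply: sub_countable (card_image_le _ _) _; exact: countableP.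
exists (fun x y => `|x - y|); split.
- split=> [x y|x y|x y|x y z]; [exact: normr_ge0| |exact: distrC|exact: ler_distD].
  by split=> [/eqP|->]; [rewrite normr_eq0 subr_eq0 => /eqP|rewrite subrr normr0].
- move=> x A; split=> [/nbhs_ballP[e e0 eA]|[e e0 eA]]; first by exists e.
  by apply/nbhs_ballP; exists e.
- move=> u Cu; apply/cvg_ex/cauchy_cvgP/cauchy_ballP => e e0.
  have [N HN] := Cu e e0; pose V := [set u n | n in [set n | (N <= n)%N]].
  exists (V, V) => [|[_ _] [/= [m Nm <-] [n Nn <-]]]; last exact: HN.
  by split; exists N => // n Nn; exists n.
Qed.

Definition baire : ptopologicalType :=
  prod_topology ((fun=> nat) : nat -> ptopologicalType).

Lemma baire_coord_continuous (k : nat) : continuous (fun f : baire => f k).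
Proof. exact: (@proj_continuous nat (fun=> nat) k). Qed.

Section baire_metric.
Context (R : realType).
Implicit Types f g h : baire.

Definition baire_dist f g : R :=
  if pselect (exists n, f n != g n) is left p then (ex_minn p).+1%:R^-1 else 0.

Lemma baire_dist_lt f g n :
  baire_dist f g < n.+1%:R^-1 <-> forall k, (k <= n)%N -> f k = g k.
Proof.
rewrite /baire_dist; case: pselect => [p|np]; last first.
  split=> [_ k _|_]; last by rewrite invr_gt0.
  by apply/eqP; apply: contrapT => fg; apply: np; exists k; apply/negP.
case: ex_minnP => m fgm mmin; rewrite ltf_pV2 ?posrE // ltr_nat ltnS.
split => [nm k kn|H].
  by apply/eqP; apply: contrapT => /negP/mmin; rewrite leqNgt (leq_ltn_trans kn nm).
by rewrite ltnNge; apply: contraNN fgm => /H ->.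
Qed.

Lemma baire_dist_ge0 f g : 0 <= baire_dist f g.
Proof. by rewrite /baire_dist; case: pselect => // p; rewrite invr_ge0. Qed.

(** A first difference at n puts the distance at 1/(n+1), so only coordinates with 1/(n+1) above e
    matter. Symmetry and the triangle inequality thereby reduce to agreement of coordinates. *)
Lemma baire_dist_le f g (e : R) : 0 <= e ->
  (forall n, e < n.+1%:R^-1 -> f n = g n) -> baire_dist f g <= e.
Proof.
move=> e0 H; rewrite /baire_dist; case: pselect => // p.
case: ex_minnP => m fgm _; rewrite leNgt; apply/negP => /H fgm'.
by move: fgm; rewrite fgm' eqxx.
Qed.

Lemma baire_dist_metric : is_metric baire_dist.
Proof.
have sym f g : baire_dist f g <= baire_dist g f.
  apply: baire_dist_le; first exact: baire_dist_ge0.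
  by move=> n /baire_dist_lt/(_ n (leqnn n)).
split=> [||f g|f g h].
- exact: baire_dist_ge0.
- move=> f g; split=> [fg0|->].
    apply/funext => k; suff /baire_dist_lt : baire_dist f g < k.+1%:R^-1 by exact.
    by rewrite fg0 invr_gt0.
  by apply/eqP; rewrite eq_le baire_dist_ge0 baire_dist_le.
- by apply/eqP; rewrite eq_le !sym.
- apply: baire_dist_le => [|n H]; first by rewrite addr_ge0 // baire_dist_ge0.
  transitivity (g n).
    apply: (proj1 (baire_dist_lt f g n)) => //.
    by apply: le_lt_trans H; rewrite lerDl baire_dist_ge0.
  apply: (proj1 (baire_dist_lt g h n)) => //.
  by apply: le_lt_trans H; rewrite lerDr baire_dist_ge0.
Qed.

(** Cylinders are neighbourhoods as finite intersections of coordinate conditions; conversely, the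
    filter they generate converges to [f] pointwise, hence in the product topology. *)
Lemma baire_nbhs f (A : set baire) :
  nbhs f A <-> exists n, [set g | forall k, (k <= n)%N -> f k = g k] `<=` A.
Proof.
split=> [fA|[n nA]]; last first.
  apply: filterS nA _.
  have : \forall g \near f, forall k : 'I_n.+1, f k = (g : baire) k.
    apply: (@filter_forall baire 'I_n.+1 (fun k g => f k = g k) (nbhs f)
      (nbhs_filter f)) => k.
    have h : nbhs (f k) [set m | f k = m].
      by rewrite nbhs_principalE; exact/principal_filterP.
    exact: (@baire_coord_continuous k f _ h).
  by apply: filterS => g H k; rewrite -ltnS => kn; exact: (H (Ordinal kn)).
pose F := filter_from [set: nat]
  (fun n => [set g : baire | forall k, (k <= n)%N -> f k = g k]).
have FF : Filter F.
  apply: filter_from_filter; first by exists 0%N.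
  move=> i j _ _; exists (maxn i j) => // g H; split => k ki; apply: H.
    by rewrite leq_max ki.
  by rewrite leq_max ki orbT.
suff Ff : F --> f by have [n _] := Ff _ fA; exists n.
apply/(@pointwise_cvgP nat nat) => t B /=.
rewrite nbhs_principalE => /principal_filterP Bf.
exists t => // g /= H; rewrite -(H t) //; exact: Bf.
Qed.

Lemma polish_baire : polish R baire.
Proof.
split.
  (* Finite sequences padded with zeros form the countable dense set. *)
  pose D (s : seq nat) : baire := nth 0%N s.
  exists (range D).
    by apply: sub_countable (card_image_le _ _) _; exact: countableP.
  move=> A [f Af] oA.
  have [n nA] : exists n, [set g | forall k, (k <= n)%N -> f k = g k] `<=` A.
    by apply/baire_nbhs; apply: open_nbhs_nbhs.
  exists (D (mkseq f n.+1)); split; last by exists (mkseq f n.+1).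
  by apply: nA => k kn; rewrite /D nth_mkseq.
exists baire_dist; split; first exact: baire_dist_metric.
- move=> f A; split=> [/baire_nbhs[n nA]|[e e0 eA]].
    exists n.+1%:R^-1; first by rewrite invr_gt0.
    by move=> g /= /baire_dist_lt H; exact: nA.
  apply/baire_nbhs; have [n ne] : exists n : nat, n.+1%:R^-1 < e.
    by have [n _ /(_ n (leqnn n))] := near_infty_natSinv_lt (PosNum e0); exists n.
  by exists n => g /baire_dist_lt H; apply: eA; exact: lt_trans ne.
- move=> u Cu.
  have /choice[N HN] : forall k, exists N, forall m n,
      (N <= m)%N -> (N <= n)%N -> u m k = u n k.
    move=> k; have [|N HN] := Cu k.+1%:R^-1; first by rewrite invr_gt0.
    by exists N => m n Nm Nn; apply: (proj1 (baire_dist_lt _ _ k) (HN m n Nm Nn)).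
  (* Each coordinate of a Cauchy sequence is eventually constant; the limit collects these
     values. *)
  exists (fun k => u (N k) k).
  apply/(@pointwise_cvgP nat nat) => t B /=.
  rewrite nbhs_principalE => /principal_filterP Bf.
  exists (N t) => // n /= Nn; rewrite -(HN t (N t) n) //; exact: Bf.
Qed.

End baire_metric.

(** * Expectations and point masses in the weak topology *)

Lemma continuous_indic_clopen (R : realType) (T : topologicalType) (A : set T) :
  open A -> closed A -> continuous (\1_A : T -> R).
Proof.
move=> oA cA; apply/continuousP => B _; rewrite preimage_indic.
by case: ifP => _; case: ifP => _ //; [exact: openT|exact: closed_openC|exact: open0].
Qed.

Section expectation.
Context (R : realType).
Implicit Types T : ptopologicalType.

Lemma Rintegral_affine_indic T (P : probability (borel T) R) (A : set T) (a b : R) :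
  measurable (A : set (borel T)) ->
  \int[P]_(y in [set: borel T]) (a + b * \1_A y) = a + b * fine (P A).
Proof.
move=> mA; have iA := @integrable_indic _ (borel T) R P A mA.
have ib : P.-integrable [set: borel T] (EFin \o (fun y => b * \1_A y)).
  by have := integrableZl measurableT b iA; apply: eq_integrable.
rewrite RintegralD //; last by apply: finite_measure_integrable_cst.
rewrite RintegralZl // Rintegral_setE // Rintegral_cst //.
by rewrite [X in fine X](_ : _ = 1%E) ?mulr1 //; exact: (@probability_setT _ _ _ P).
Qed.

(** This bound and its converse below serve to estimate means of tents, which are compared with a
    constant plus a multiple of an indicator. *)
Lemma le_Rintegral_affine_indic T (P : probability (borel T) R) (f : T -> R)
    (A : set T) (a b : R) :
  measurable_fun setT (f : borel T -> R) -> (exists M : R, forall y, `|f y| <= M) ->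
  measurable (A : set (borel T)) -> (forall y, f y <= a + b * \1_A y) ->
  \int[P]_(y in [set: borel T]) f y <= a + b * fine (P A).
Proof.
move=> mf bf mA H; rewrite -Rintegral_affine_indic //.
apply: le_Rintegral => //; first exact: bounded_integrable.
apply: bounded_integrable.
  apply: measurable_funD => //; apply: measurable_funM => //; exact: measurable_indic.
exists (`|a| + `|b|) => y; rewrite (le_trans (ler_normD _ _)) // lerD2l normrM indicE.
by case: (y \in A); rewrite ?normr1 ?normr0 ?mulr1 ?mulr0.
Qed.

Lemma ge_Rintegral_affine_indic T (P : probability (borel T) R) (f : T -> R)
    (A : set T) (a b : R) :
  measurable_fun setT (f : borel T -> R) -> (exists M : R, forall y, `|f y| <= M) ->
  measurable (A : set (borel T)) -> (forall y, a + b * \1_A y <= f y) ->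
  a + b * fine (P A) <= \int[P]_(y in [set: borel T]) f y.
Proof.
move=> mf bf mA H; rewrite -Rintegral_affine_indic //.
apply: le_Rintegral => //; last exact: bounded_integrable.
apply: bounded_integrable.
  apply: measurable_funD => //; apply: measurable_funM => //; exact: measurable_indic.
exists (`|a| + `|b|) => y; rewrite (le_trans (ler_normD _ _)) // lerD2l normrM indicE.
by case: (y \in A); rewrite ?normr1 ?normr0 ?mulr1 ?mulr0.
Qed.

Lemma expectation_continuous T (f : T -> R) :
  continuous f -> (exists M : R, forall y, `|f y| <= M) ->
  continuous (fun mu : Delta R T => \int[sval mu]_(y in [set: borel T]) f y).
Proof.
move=> cf bf; pose b : bounded_continuous R T := exist _ f (conj cf bf).
move=> mu; apply: (@continuous_comp _ _ _ (@expectations R T) (fun g => g b)).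
  exact: initial_continuous.
exact: (@proj_continuous (bounded_continuous R T) (fun=> R) b).
Qed.

(** The indicator of a clopen set is continuous, so its expectation is weakly continuous. *)
Lemma closed_clopen_full T (A : set T) : open A -> closed A ->
  closed [set mu : Delta R T | sval mu A = 1%E].
Proof.
move=> oA cA.
have cE : continuous (fun mu : Delta R T =>
    \int[sval mu]_(y in [set: borel T]) (\1_A y : R)).
  apply: expectation_continuous; first exact: continuous_indic_clopen.
  by exists 1 => y; rewrite indicE; case: (y \in A); rewrite ?normr1 ?normr0.
have mA : measurable (A : set (borel T)) by exact: borel_open.
rewrite (_ : [set mu | _] = (fun mu : Delta R T =>
    \int[sval mu]_(y in [set: borel T]) (\1_A y : R)) @^-1` [set 1]).
  by apply: preimage_closed => //; exact: closed_eq.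
apply/seteqP; split=> mu /=; rewrite Rintegral_setE //; first by move=> ->.
by move=> h; rewrite -[LHS]fineK ?fin_num_measure // h.
Qed.

Lemma probability1_bigcap d (Z : measurableType d) (P : probability Z R)
    (F : (set Z)^nat) :
  (forall k, measurable (F k)) -> (forall k, P (F k) = 1%E) ->
  P (\bigcap_k F k) = 1%E.
Proof.
move=> mF F1; have mI : measurable (\bigcap_k F k) by exact: bigcapT_measurable.
rewrite -[X in P X]setCK probability_setC; last exact: measurableC.
have nF k : P (~` F k) = 0%E by rewrite probability_setC // F1 subee.
suff -> : P (~` \bigcap_k F k) = 0%E by rewrite sube0.
apply/negligibleP; first exact: measurableC.
rewrite setC_bigcap; apply: negligible_bigcup => k.
by apply/negligibleP; [exact: measurableC|exact: nF].
Qed.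

Lemma baire_cylinder_clopen (B : set nat) k :
  open [set f : baire | B (f k)] /\ closed [set f : baire | B (f k)].
Proof.
have /continuousP ck := @baire_coord_continuous k.
split; first by apply: (ck B); exact: discrete_open.
by rewrite -openC; apply: (ck (~` B)); exact: discrete_open.
Qed.

Lemma baire_set1E (f : baire) : [set f] = \bigcap_k [set g : baire | g k = f k].
Proof.
apply/seteqP; split => [_ -> //|g H]; apply/funext => k; exact: H.
Qed.

Lemma measurable_baire_set1 (f : baire) : measurable ([set f] : set (borel baire)).
Proof.
rewrite baire_set1E; apply: bigcapT_measurable => k; apply: borel_open.
exact: (baire_cylinder_clopen [set f k] k).1.
Qed.

(** A singleton is a countable intersection of clopen cylinders; this turns being a point mass into
    countably many closed conditions. *)
Lemma point_mass_coord (mu : Delta R baire) (f : baire) :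
  sval mu [set f] = 1%E <-> forall k, sval mu [set g : baire | g k = f k] = 1%E.
Proof.
have mk k : measurable ([set g : baire | g k = f k] : set (borel baire)).
  by apply: borel_open; exact: (baire_cylinder_clopen [set f k] k).1.
split=> [h k|h]; last first.
  by rewrite baire_set1E; apply: (@probability1_bigcap _ (borel baire)).
apply/eqP; rewrite eq_le probability_le1 // -h le_measure // ?inE //.
  exact: measurable_baire_set1.
by move=> _ ->.
Qed.

Lemma closed_point_mass (f : baire) :
  closed [set mu : Delta R baire | sval mu [set f] = 1%E].
Proof.
rewrite (_ : [set mu | _] = \bigcap_k
    [set mu : Delta R baire | sval mu [set g : baire | g k = f k] = 1%E]).
  apply: closed_bigI => k _.
  by apply: closed_clopen_full; apply (baire_cylinder_clopen [set f k] k).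
apply/seteqP; split => [mu /point_mass_coord h k _|mu h]; first exact: h.
by apply/point_mass_coord => k; exact: h.
Qed.

End expectation.

(** * Test functions detecting atoms *)

Section test.
Context (R : realType).
Implicit Types (k n : nat) (q x : R).

(* The factor 1 + 1/(n+1) makes every tent reach exactly the maximum 1, so that
   it is optimal against the point mass at q. *)
Definition tent n q x : R :=
  1 - (1 + n.+1%:R^-1) * Num.min 1 (4 * n.+1%:R * `|x - q|).

(** The code of [None] is reserved for the strategy that always earns 0; numbers coding nothing give
    the zero function too. *)
Definition test k x : R :=
  if unpickle k is Some (Some (n, q)) then tent n (ratr (q : rat)) x else 0.

Lemma tent_continuous n q : continuous (tent n q).
Proof.
move=> x; apply: cvgB; first exact: cvg_cst.
apply: cvgM; first exact: cvg_cst.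
apply: (@continuous_min R R (cst 1) (fun x => 4 * n.+1%:R * `|x - q|)).
  exact: cvg_cst.
apply: cvgM; first exact: cvg_cst.
apply: cvg_norm; apply: cvgB; [exact: cvg_id|exact: cvg_cst].
Qed.

Lemma tent_bounds n q x : - n.+1%:R^-1 <= tent n q x <= 1.
Proof.
have n0 : 0 < n.+1%:R^-1 :> R by rewrite invr_gt0.
have c : 0 <= 4 * n.+1%:R * `|x - q| by rewrite mulr_ge0.
rewrite /tent; set m := Num.min _ _.
have m1 : m <= 1 by rewrite ge_min lexx.
have m0 : 0 <= m by rewrite le_min ler01 c.
have h1 : (1 + n.+1%:R^-1) * m <= 1 + n.+1%:R^-1 by rewrite ler_piMr // addr_ge0 // ltW.
have h2 : 0 <= (1 + n.+1%:R^-1) * m by rewrite mulr_ge0 // addr_ge0 // ltW.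
have aux (i v : R) : v <= 1 + i -> 0 <= v -> - i <= 1 - v <= 1.
  by move=> ? ?; apply/andP; split; lra.
exact: aux.
Qed.

Lemma tent_norm n q x : `|tent n q x| <= 1.
Proof.
have /andP[h1 h2] := tent_bounds n q x; rewrite ler_norml h2 andbT (le_trans _ h1) //.
by rewrite lerN2 invf_le1 // ler1n.
Qed.

Lemma tent_center n q : tent n q q = 1.
Proof. by rewrite /tent subrr normr0 mulr0 minEle ler10 mulr0 subr0. Qed.

Lemma test_continuous k : continuous (test k).
Proof.
rewrite /test; case: unpickle => [[[n q]|]|]; first exact: tent_continuous.
  by move=> x; exact: cvg_cst.
by move=> x; exact: cvg_cst.
Qed.

Lemma test_norm k x : `|test k x| <= 1.
Proof.
rewrite /test; case: unpickle => [[[n q]|]|]; first exact: tent_norm.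
  by rewrite normr0.
by rewrite normr0.
Qed.

Lemma test_le1 k x : test k x <= 1.
Proof. exact: le_trans (ler_norm _) (test_norm k x). Qed.

Lemma test_pickle_tent n (q : rat) : test (pickle (Some (n, q))) = tent n (ratr q).
Proof. by apply/funext => x; rewrite /test pickleK. Qed.

Lemma test_pickle_None : test (pickle (None : option (nat * rat))) = cst 0.
Proof. by apply/funext => x; rewrite /test pickleK. Qed.

Lemma test_measurable k : measurable_fun setT (test k : borel R -> R).
Proof. by apply: continuous_borel_fun; exact: test_continuous. Qed.

Lemma test_bounded k : exists M : R, forall x, `|test k x| <= M.
Proof. by exists 1 => x; exact: test_norm. Qed.

Lemma borel_set1 x : measurable ([set x] : set (borel R)).
Proof. apply: borel_closed; exact: closed_eq. Qed.

(** With i = 1/(n+1), a tent centred near a is at least (1 - i)/2 at a and at least -i elsewhere. A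
    nonpositive mean therefore bounds the mass of a by 2i/(1 + i), which is arbitrarily small. *)
Lemma test_atomless (P : probability (borel R) R) :
  (forall k, \int[P]_(x in [set: borel R]) test k x <= 0) -> forall a, P [set a] = 0%E.
Proof.
move=> H a; have fa : P [set a] \is a fin_num.
  by rewrite fin_num_measure //; exact: borel_set1.
have pa : 0 <= fine (P [set a]) by rewrite fine_ge0.
rewrite -[LHS]fineK //; congr EFin; apply/eqP; rewrite eq_le pa andbT.
apply/ler_addgt0Pl => _/posnumP[e]; rewrite addr0.
have e2 : 0 < e%:num / 2 by rewrite divr_gt0.
have [n _ /(_ n (leqnn n)) /= ne] := near_infty_natSinv_lt (PosNum e2).
have n0 : 0 < n.+1%:R^-1 :> R by rewrite invr_gt0.
(* At this distance the minimum in the tent is at most 4/8 = 1/2 at a. *)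
have [q qa] : exists q : rat, `|a - ratr q| <= 8^-1 * n.+1%:R^-1.
  have [|q] := @rat_in_itvoo R (a - 8^-1 * n.+1%:R^-1) (a + 8^-1 * n.+1%:R^-1).
    by rewrite ltrBlDr -addrA ltrDl addr_gt0 // mulr_gt0 // invr_gt0.
  by rewrite in_itv /= => /andP[h1 h2]; exists q; rewrite ler_distlC !ltW.
have := H (pickle (Some (n, q))); rewrite test_pickle_tent.
have h : forall x,
    - n.+1%:R^-1 + (1 + n.+1%:R^-1) / 2 * \1_[set a] x <= tent n (ratr q) x.
  move=> x; have [->|xa] := eqVneq x a; last first.
    rewrite indicE memNset ?mulr0 ?addr0; last by move=> /= /eqP; apply/negP.
    by case/andP: (tent_bounds n (ratr q) x).
  rewrite indicE mem_set // mulr1 /tent; set m := Num.min _ _.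
  have m2 : m <= 2^-1.
    rewrite ge_min; apply/orP; right; apply: le_trans (ler_wpM2l _ qa) _.
      by rewrite mulr_ge0.
    have -> : 4 * n.+1%:R * (8^-1 * n.+1%:R^-1) = 2^-1 :> R by field.
    by [].
  have aux (i v : R) : 0 < i -> v <= 2^-1 ->
    - i + (1 + i) / 2 <= 1 - (1 + i) * v by move=> ? ?; nra.
  exact: aux.
have := @ge_Rintegral_affine_indic _ _ P (tent n (ratr q)) [set a] _ _
  (continuous_borel_fun (@tent_continuous n (ratr q)))
  (ex_intro _ 1 (tent_norm n (ratr q))) (borel_set1 a) h.
move=> h1 h2; have := le_trans h1 h2.
have aux (i v r : R) : 0 < i -> i < r / 2 -> 0 <= v ->
  - i + (1 + i) / 2 * v <= 0 -> v <= r by move=> *; nra.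
exact: aux.
Qed.

End test.

(** * The uniform distribution on the unit interval *)

Section uniform.
Context (R : realType).

Lemma measurable_borel_lebesgue (A : set R) :
  measurable (A : set (borel R)) -> measurable A.
Proof.
apply: smallest_sub => [|B oB]; first exact: sigma_algebra_measurable.
exact: open_measurable.
Qed.

Definition uniform01 (A : set (borel R)) : \bar R :=
  (@lebesgue_measure R) (A `&` `[0, 1]).

Let uniform01_0 : uniform01 set0 = 0%E.
Proof. by rewrite /uniform01 set0I measure0. Qed.

Let uniform01_ge0 A : (0 <= uniform01 A)%E.
Proof. exact: measure_ge0. Qed.

Let uniform01_sigma_additive : semi_sigma_additive uniform01.
Proof.
move=> F mF tF mUF; rewrite /uniform01 setI_bigcupl.
apply: measure_semi_sigma_additive.
- by move=> i; apply: measurableI => //; exact: measurable_borel_lebesgue (mF i).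
- exact: trivIset_setIr.
- rewrite -setI_bigcupl; apply: measurableI => //.
  exact: measurable_borel_lebesgue mUF.
Qed.

HB.instance Definition _ := isMeasure.Build _ _ _ uniform01
  uniform01_0 uniform01_ge0 uniform01_sigma_additive.

Let uniform01_T : uniform01 setT = 1%E.
Proof. by rewrite /uniform01 setTI lebesgue_measure_itv /= lte_fin ltr01 sube0. Qed.

HB.instance Definition _ := Measure_isProbability.Build _ _ _ uniform01 uniform01_T.

(** With i = 1/(n+1), a tent equals -i off an interval [A] of length i/2 and is at most 1 on it, so
    its mean is at most -i + (1 + i) i/2, which is nonpositive because i <= 1. *)
Lemma uniform01_test k : \int[uniform01]_(x in [set: borel R]) test k x <= 0.
Proof.
rewrite /test; case: unpickle => [[[n q]|]|]; last 2 first.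
- by rewrite Rintegral_cst // mul0r.
- by rewrite Rintegral_cst // mul0r.
pose i : R := n.+1%:R^-1; pose A : set R := `[ratr q - i / 4, ratr q + i / 4]%classic.
have i0 : 0 < i by rewrite invr_gt0.
have i1 : i <= 1 by rewrite invf_le1 // ler1n.
have mA : measurable (A : set (borel R)) by apply: borel_closed; exact: itv_closed.
have PA : fine (uniform01 A) <= i / 2.
  have h : (uniform01 A <= (i / 2)%:E)%E.
    apply: (@le_trans _ _ (@lebesgue_measure R A)).
      apply: le_measure => //.
      - by rewrite inE; apply: measurableI; exact: measurable_itv.
      - by rewrite inE; exact: measurable_itv.
    rewrite lebesgue_measure_itv /= lte_fin; case: ifP => _; last first.
      by rewrite lee_fin divr_ge0 // ltW.
    by rewrite -EFinB lee_fin le_eqVlt; apply/orP; left; apply/eqP; field.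
  by rewrite -lee_fin fineK // fin_num_measure.
have h : forall x, tent n (ratr q) x <= - i + (1 + i) * \1_A x.
  move=> x; rewrite indicE; have [/set_mem Ax|/negP nAx] := boolP (x \in A).
    rewrite mulr1 addrCA addNr addr0.
    by have /andP[_] := tent_bounds n (ratr q : R) x.
  rewrite mulr0 addr0 /tent minEle; case: ifPn => [_|].
    by rewrite mulr1 opprD addrA subrr add0r.
  rewrite -ltNge => H; exfalso; apply: nAx; apply/mem_set.
  rewrite /A /= in_itv /= -ler_distl.
  move: H; rewrite -[n.+1%:R]invrK -/i => H.
  have : `|x - ratr q| = i / 4 * (4 * i^-1 * `|x - ratr q|) by field; rewrite gt_eqF.
  by move=> ->; apply: ler_piMr; [exact: divr_ge0 (ltW i0) _|exact: ltW].
have := @le_Rintegral_affine_indic _ _ uniform01 (tent n (ratr q)) A _ _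
  (continuous_borel_fun (@tent_continuous R n (ratr q)))
  (ex_intro _ 1 (tent_norm n (ratr q))) mA h.
move=> /le_trans; apply; move: PA i0 i1; rewrite -/i; clearbody i.
by move: (fine _) => r *; nra.
Qed.

End uniform.

(** * Integrals against normalized and Dirac measures *)

Lemma mkDeltaE (R : realType) (T : ptopologicalType) (P : probability (borel T) R) A :
  measurable A -> sval (mkDelta P) A = P A.
Proof. by rewrite /mkDelta /= /zero_off; case: pselect. Qed.

Lemma Rintegral_mkDelta (R : realType) (T : ptopologicalType)
    (P : probability (borel T) R) (f : T -> R) :
  \int[sval (mkDelta P)]_(x in [set: borel T]) f x =
  \int[P]_(x in [set: borel T]) f x.
Proof. by congr fine; apply: eq_measure_integral => A mA _; exact: mkDeltaE. Qed.

Lemma Rintegral_dirac (R : realType) (T : ptopologicalType) (a : T) (f : T -> R) :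
  measurable_fun setT (f : borel T -> R) ->
  \int[dirac (a : borel T)]_(x in [set: borel T]) f x = f a.
Proof.
move=> mf; rewrite /Rintegral integral_dirac //; last exact/measurable_EFinP.
by rewrite diracT mul1e.
Qed.

Lemma fst_continuous (T U : topologicalType) : continuous (@fst T U).
Proof. by move=> p; exact: cvg_fst. Qed.

Lemma snd_continuous (T U : topologicalType) : continuous (@snd T U).
Proof. by move=> p; exact: cvg_snd. Qed.

(** * The game and its best responses *)

Section scale_game.
Context (R : realType) (x : R -> nat -> nat).
Hypothesis scale_x : forall g : nat -> nat,
  countable [set s | exists n, forall k, (n <= k)%N -> (x s k <= g k)%N].

Local Notation Rp := (R : ptopologicalType).
Local Notation mean P k := (\int[P]_(t in [set: borel R]) @test R k t).

Definition scale_payoff1 (p : baire * Rp) : R := @test R (p.1 0%N) p.2.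

Definition scale_payoff2 (p : baire * Rp) : R :=
  \1_[set p : baire * Rp | p.2 = 0 \/ p.1 = x p.2] p.

Lemma scale_payoff1_bounded : exists M : R, forall p, `|scale_payoff1 p| <= M.
Proof. by exists 1 => p; exact: test_norm. Qed.

Lemma scale_payoff2_bounded : exists M : R, forall p, `|scale_payoff2 p| <= M.
Proof.
exists 1 => p; rewrite /scale_payoff2 indicE.
by case: (p \in _); rewrite ?normr1 ?normr0.
Qed.

Lemma scale_payoff1_measurable :
  @universally_measurable_fun R (baire * Rp)%type scale_payoff1.
Proof.
move=> B mB; apply: measurable_universally.
rewrite (_ : scale_payoff1 @^-1` B = \bigcup_k
    ((fun p : baire * Rp => p.1) @^-1` [set f : baire | f 0%N = k] `&`
     (fun p : baire * Rp => p.2) @^-1` (@test R k @^-1` B))).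
  apply: bigcupT_measurable => k; apply: measurableI.
    apply: continuous_borel; first exact: fst_continuous.
    by apply: borel_open; exact: (baire_cylinder_clopen [set k] 0).1.
  apply: continuous_borel; first exact: snd_continuous.
  by rewrite -[X in measurable X]setTI; exact: test_measurable.
apply/seteqP; split => [p Bp|p [k _ [/= <- //]]].
by exists (p.1 0%N).
Qed.

(** The graph of [x] is treated by the scale argument, with the second coordinate as parameter and
    the sets m < y k as sieve; its fibres are single points. *)
Lemma scale_payoff2_measurable :
  @universally_measurable_fun R (baire * Rp)%type scale_payoff2.
Proof.
pose S := [set p : baire * Rp | p.1 = x p.2].
have mS : universally_measurable R S.
  apply: (@scale_universally_measurable R x scale_x (baire * Rp)%type S snd
    (fun k m => [set p : baire * Rp | (m < p.1 k)%N])).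
  - move=> k m; apply: (@continuous_borel (baire * Rp)%type baire fst
      [set f : baire | (m < f k)%N]).
      exact: fst_continuous.
    by apply: borel_open; exact: (baire_cylinder_clopen [set i | (m < i)%N] k).1.
  - by move=> k m p; exact: ltnW.
  - move=> k; apply/seteqP; split => // p /(_ (p.1 k) I) /=.
    by rewrite ltnn.
  - by move=> p /= ->.
  - move=> s; rewrite (_ : _ `&` _ = fst @^-1` [set x s : baire] `&` snd @^-1` [set s]).
      apply: measurableI.
        by apply: continuous_borel; [exact: fst_continuous|exact: measurable_baire_set1].
      by apply: continuous_borel; [exact: snd_continuous|exact: borel_set1].
    by apply/seteqP; split => -[f t]; rewrite /S /= => -[-> ->]; split.
have mD : universally_measurable R [set p : baire * Rp | p.2 = 0 \/ p.1 = x p.2].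
  apply: universally_measurableU mS; apply: measurable_universally.
  apply: (@continuous_borel (baire * Rp)%type Rp snd [set 0]).
    exact: snd_continuous.
  exact: borel_set1.
move=> B _; rewrite /scale_payoff2 preimage_indic.
case: ifP => _; case: ifP => _ //.
- by apply: measurable_universally; exact: measurableT.
- exact: universally_measurableC.
- by apply: measurable_universally; exact: measurable0.
Qed.

Definition scale_game : game R :=
  Game (polish_baire R) (polish_real R) scale_payoff1_bounded scale_payoff2_bounded
    scale_payoff1_measurable scale_payoff2_measurable.

Lemma expected1 (y : baire) (mu : Delta R Rp) :
  @expected_payoff R scale_game P1 y mu = mean (sval mu) (y 0%N).
Proof. by apply: integral_completion; [exact: test_measurable|exact: test_bounded]. Qed.

Lemma expected2 (s : Rp) (mu : Delta R baire) :
  @expected_payoff R scale_game P2 s mu =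
  if s == 0 then 1 else fine (sval mu [set x s : baire]).
Proof.
(* An affine function of one indicator covers both cases, so that [Rintegral_affine_indic]
   applies. *)
pose f (t : baire) : R :=
  (if s == 0 then 1 else 0) + (if s == 0 then 0 else 1) * \1_[set x s : baire] t.
have e (t : baire) : @own_payoff R scale_game P2 s t = f t.
  rewrite /f /own_payoff /= /scale_payoff2 !indicE.
  have [->|/eqP s0] := eqVneq; first by rewrite mem_set ?mul0r ?addr0 //=; left.
  rewrite mul1r add0r; congr (_ %:R); congr nat_of_bool.
  by apply/idP/idP => /set_mem H; apply/mem_set; [case: H|right].
rewrite /expected_payoff (_ : @own_payoff R scale_game P2 s = f); last exact/funext.
have m1 := measurable_baire_set1 (x s : baire).
rewrite integral_completion.
- rewrite Rintegral_affine_indic //.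
  by case: ifP => _; rewrite ?mul0r ?addr0 ?mul1r ?add0r.
- by apply: measurable_funD => //; apply: measurable_funM => //; exact: measurable_indic.
- exists 1 => t; rewrite /f indicE.
  case: (_ == _); rewrite ?mul0r ?addr0 ?add0r ?mul1r ?normr1 //.
  by case: (_ \in _); rewrite ?normr1 ?normr0.
Qed.

Lemma best_response1 (y : baire) (mu : Delta R Rp) :
  @best_response R scale_game P1 y mu <->
  forall k, mean (sval mu) k <= mean (sval mu) (y 0%N).
Proof.
split=> H; last by move=> y'; rewrite !expected1.
by move=> k; have := H (fun=> k); rewrite !expected1.
Qed.

(** Strategy 0 guarantees the maximal payoff 1, so a best response must earn exactly 1. *)
Lemma best_response2 (s : Rp) (mu : Delta R baire) :
  @best_response R scale_game P2 s mu <->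
  s = 0 \/ sval mu [set x s : baire] = 1%E.
Proof.
have le1 t : @expected_payoff R scale_game P2 t mu <= 1.
  have mt := measurable_baire_set1 (x t : baire).
  rewrite expected2; case: ifP => // _; rewrite -lee_fin fineK ?fin_num_measure //.
  exact: probability_le1 (measurable_baire_set1 _).
split=> [/(_ (0 : Rp))|].
  rewrite !expected2 eqxx; case: eqVneq => [->|s0 h]; [by left|right].
  have mx := measurable_baire_set1 (x s : baire).
  apply/eqP; rewrite eq_le probability_le1 //= -[X in (_ <= X)%E]fineK ?fin_num_measure //.
move=> H t; apply: le_trans (le1 t) _; rewrite expected2.
by case: eqVneq => // /eqP s0; case: H => [//|->].
Qed.

(** * Point-mass beliefs along the scale *)

Section point_mass_sieve.
Context (T : ptopologicalType) (sigma : T -> R) (phi : T -> Delta R baire).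
Hypothesis cphi : continuous phi.

(** The scale argument is run on beliefs instead of sequences: certainty that coordinate k exceeds m
    is a closed condition, and the point mass at [x (sigma z)] meets it whenever m < x (sigma z)
    k. *)
Let U k m :=
  phi @^-1` [set mu : Delta R baire | sval mu [set f : baire | (m < f k)%N] = 1%E].
Let S := [set z : T | sval (phi z) [set x (sigma z) : baire] = 1%E].

Let mtail k m : measurable ([set f : baire | (m < f k)%N] : set (borel baire)).
Proof. by apply: borel_open; exact: (baire_cylinder_clopen [set i | (m < i)%N] k).1. Qed.

Let full_sub (mu : Delta R baire) (A B : set (borel baire)) :
  measurable A -> measurable B -> A `<=` B -> sval mu A = 1%E -> sval mu B = 1%E.
Proof.
move=> mA mB AB A1; apply/eqP; rewrite eq_le probability_le1 //= -A1 le_measure // inE //.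
Qed.

Let mU k m : measurable (U k m : set (borel T)).
Proof.
apply: continuous_borel => //; apply: borel_closed.
by apply: closed_clopen_full; apply (baire_cylinder_clopen [set i | (m < i)%N] k).
Qed.

Let Ud k m : U k m.+1 `<=` U k m.
Proof. by move=> z; apply: full_sub => // f /=; exact: ltnW. Qed.

(** A belief certain of every bound would give probability one to an empty intersection. *)
Let U0 k : \bigcap_m U k m = set0.
Proof.
apply/seteqP; split => // z H.
have := @probability1_bigcap R _ (borel baire) (sval (phi z))
  (fun m => [set f : baire | (m < f k)%N]) (mtail k) (fun m => H m I).
rewrite (_ : \bigcap_m _ = set0).
  by rewrite measure0 => /eqP; rewrite eq_sym onee_eq0.
by apply/seteqP; split => // f /(_ (f k) I) /=; rewrite ltnn.
Qed.

Let SU z : S z -> forall k m, (m < x (sigma z) k)%N -> U k m z.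
Proof.
move=> Sz k m mx; apply: full_sub Sz => //; first exact: measurable_baire_set1.
by move=> _ ->.
Qed.

Lemma point_mass_negligible (P : probability (borel T) R) :
  exists2 A : set R, countable A & P.-negligible (S `\` sigma @^-1` A).
Proof. exact: (@scale_negligible R x scale_x T S sigma U mU Ud U0 SU P). Qed.

Lemma point_mass_universally_measurable :
  continuous sigma -> universally_measurable R S.
Proof.
move=> csigma.
apply: (@scale_universally_measurable R x scale_x T S sigma U mU Ud U0 SU) => s.
rewrite (_ : _ `&` _ =
    phi @^-1` [set mu : Delta R baire | sval mu [set x s : baire] = 1%E]
    `&` sigma @^-1` [set s]).
  apply: measurableI; last by apply: continuous_borel; [exact: csigma|exact: borel_set1].
  by apply: continuous_borel => //; apply: borel_closed; exact: closed_point_mass.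
by apply/seteqP; split => z [+ /= zs]; rewrite /S /= zs.
Qed.

End point_mass_sieve.

(** For player 1 the relation is Borel: a countable union over the value of y 0 of clopen conditions
    on y joined to closed conditions on the belief. For player 2 the sieve applies on pairs, with
    the strategy as parameter. *)
Lemma universally_measurable_BR (i : player) :
  universally_measurable R (BR scale_game i).
Proof.
case: i.
  apply: measurable_universally.
  rewrite (_ : BR scale_game P1 = \bigcup_k
      ((fst @^-1` [set f : baire | f 0%N = k] : set (baire * Delta R Rp)) `&`
       snd @^-1` (\bigcap_j [set mu : Delta R Rp |
         mean (sval mu) j - mean (sval mu) k <= 0]))).
    apply: bigcupT_measurable => k; apply: measurableI.
      apply: continuous_borel; first exact: fst_continuous.
      by apply: borel_open; exact: (baire_cylinder_clopen [set k] 0).1.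
    apply: continuous_borel; first exact: snd_continuous.
    apply: borel_closed; apply: closed_bigI => j _.
    apply: (@preimage_closed _ _ (fun mu : Delta R Rp =>
      mean (sval mu) j - mean (sval mu) k) [set u | u <= 0]); last exact: closed_le.
    have ce l : continuous (fun mu : Delta R Rp => mean (sval mu) l).
      by apply: expectation_continuous; [exact: test_continuous|exact: test_bounded].
    by move=> mu _; apply: cvgB; [exact: nbhs_filter|exact: ce|exact: ce].
  apply/seteqP; split => [[y mu] /best_response1 H|[y mu] [k _ [/= yk H]]].
    by exists (y 0%N) => //; split => // k _ /=; rewrite subr_le0.
  by apply/best_response1 => j; rewrite /= -subr_le0 yk; exact: H.
rewrite (_ : BR scale_game P2 = [set p : Rp * Delta R baire | p.1 = 0] `|`
    [set p : Rp * Delta R baire | sval p.2 [set x p.1 : baire] = 1%E]).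
  apply: universally_measurableU.
    apply: measurable_universally.
    apply: (@continuous_borel (Rp * Delta R baire)%type Rp fst [set 0]).
      exact: fst_continuous.
    exact: borel_set1.
  apply: (@point_mass_universally_measurable (Rp * Delta R baire)%type fst snd).
    exact: snd_continuous.
  exact: fst_continuous.
by apply/seteqP; split => [[s mu] /best_response2 H|[s mu] H]; [|apply/best_response2].
Qed.

(** * Every strategy is rationalizable *)

Lemma fullT (T : ptopologicalType) (mu : Delta R T) : full mu setT.
Proof.
split; first exact: measurable_completion_measurable.
by rewrite completionE // (@probability_setT _ _ _ (sval mu)).
Qed.

(** A tent attains the maximum 1 against the Dirac mass at its centre; the zero function is optimal
    against the uniform distribution, where no test has positive mean. Player 2 believes in the
    point mass at [x s]. *)
Lemma exists_best_response (i : player) (s : strat scale_game i) :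
  exists mu, BR scale_game i (s, mu).
Proof.
case: i s => s.
  suff [P HP] : exists P : probability (borel R) R, forall k,
      mean P k <= mean P (s 0%N).
    by exists (mkDelta P); apply/best_response1 => k; rewrite !Rintegral_mkDelta.
  rewrite {2}/test; case: (unpickle (s 0%N)) => [[[n q]|]|].
  - exists (dirac (ratr q : borel R)) => k; rewrite !Rintegral_dirac //.
    + by rewrite tent_center test_le1.
    + by apply: continuous_borel_fun; exact: tent_continuous.
    + exact: test_measurable.
  - by exists (@uniform01 R) => k; rewrite [leRHS]Rintegral_cst // mul0r uniform01_test.
  - by exists (@uniform01 R) => k; rewrite [leRHS]Rintegral_cst // mul0r uniform01_test.
exists (mkDelta (dirac (x s : borel baire))); apply/best_response2; right.
by rewrite mkDeltaE; [rewrite /= /dirac indicE mem_set|exact: measurable_baire_set1].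
Qed.

(* No strategy is ever eliminated: a one-point well-order suffices. *)
Lemma all_rationalizable (i : player) (s : strat scale_game i) : RAT scale_game i s.
Proof.
exists unit, (fun _ _ => true), (fun _ _ => setT), tt; split => //.
- by move=> A [[] Att]; exists tt; split; [split|move=> []].
- move=> []; split.
  + by [].
  + by move=> [] [[]].
  + by move=> [[]] [] [_].
- split; last by move=> [] [_].
  move=> j; rewrite /eliminate setTI; apply/seteqP; split => // t _.
  by have [mu Hmu] := exists_best_response t; exists mu; split => //; exact: fullT.
Qed.

(** * The null strategy is inconsistent with RCBR *)

Lemma rationality0_P2 (p : strat scale_game P2 * beliefs scale_game P2) :
  rationality scale_game 0 P2 p ->
  p.1 = 0 \/ sval (p.2 0%N : Delta R baire) [set x p.1 : baire] = 1%E.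
Proof.
move=> [_ [nu [mu [snu numu /best_response2 /= [->|H]]]]]; [by left|right].
have mx := measurable_baire_set1 (x p.1 : baire).
(* Since [truncate] at level 0 is the first projection, the marginal of the extension is the
   first-order belief. *)
by rewrite -H (numu _ mx) (snu 0%N _ mx).
Qed.

Lemma null_strategy_not_RCBR (y : baire) :
  @test R (y 0%N) = cst 0 -> ~ RCBR scale_game P1 y.
Proof.
move=> y0 [t Tt H].
have [_ [nu0 [mu [snu0 numu /best_response1 Hmu]]]] := H 0%N.
have [_ [nu [snu [_ nufull]]]] := H 1%N.
(* Earning 0 is optimal, so no test has positive mean under the belief. *)
have mu_atomless a : sval mu [set a] = 0%E.
  apply: (test_atomless (P := sval mu)) => k; apply: le_trans (Hmu k) _.
  by rewrite /= y0 Rintegral_cst // mul0r.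
pose Z : ptopologicalType := (strat scale_game P2 * beliefs scale_game P2)%type.
have mfst a : measurable (fst @^-1` [set a] : set (borel Z)).
  by apply: (@continuous_borel Z Rp); [exact: fst_continuous|exact: borel_set1].
have nu_fst a : sval nu (fst @^-1` [set a]) = 0%E.
  have ma : measurable ([set a] : set (borel Rp)) by exact: borel_set1.
  (* Both extensions [nu] and [nu0] have the first-order belief of t as first marginal. *)
  by rewrite -(snu 0%N _ ma) (snu0 0%N _ ma) -(numu _ ma) mu_atomless.
pose phi (z : Z) : Delta R baire := z.2 0%N.
have cphi : continuous phi.
  move=> z; apply: (@continuous_comp _ _ _ snd (fun d : beliefs scale_game P2 => d 0%N)).
    exact: snd_continuous.
  exact: (@proj_continuous nat (fun n => Delta R (hier scale_game n P2)) 0%N).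
have [A cA nS] := @point_mass_negligible Z fst phi cphi (sval nu).
(* Rational pairs have strategy 0, or a strategy in the countable set [A], or lie in the null set
   [nS]; the first two kinds fill countably many null fibres. *)
pose B := \bigcup_(a in [set 0] `|` A) (fst @^-1` [set a] : set (borel Z)).
have nB : (sval nu).-negligible B.
  apply: countable_bigcup_negligible => [|a _].
    exact: countable_setU.
  by exists (fst @^-1` [set a]); split; [exact: mfst|exact: nu_fst|].
have [M [mM M0 BSM]] := negligibleU nB nS.
(* The completed measure is an outer measure, hence monotone on all sets: a set of measure one would
   sit inside the null set [M]. *)
have : (completion (sval nu) (rationality scale_game 0 P2) <= completion (sval nu) M)%E.
  apply: le_mu_ext => p /rationality0_P2 h; apply: BSM.
  have [Ap|nAp] := pselect (A p.1); first by left; exists p.1 => //; right.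
  by case: h => [p0|h]; [left; exists p.1 => //; left|right].
by rewrite nufull completionE // M0 lee_fin ler10.
Qed.

End scale_game.

Theorem theorem5 (R : realType) (CH : continuum_hypothesis R) :
  exists G : game R,
    (forall i : player, universally_measurable R (BR G i)) /\
    exists i : player, ~ (RAT G i `<=` RCBR G i).
Proof.
have [x scale_x] := CH_scale CH; exists (scale_game scale_x).
split; first exact: universally_measurable_BR.
(* The constant sequence at the code of [None] selects the zero test function. *)
exists P1 => /(_ (fun=> pickle (None : option (nat * rat))) (all_rationalizable _)).
apply: null_strategy_not_RCBR; exact: test_pickle_None.
Qed.
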